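(* Suppose that $\mathbf{0}\in\mathcal{F}$, or equivalently, $b(y)\ge0$ for all $y\in S$. Then the feasible set $\mathcal{F}$ is compact if and only if $$\min\{r^+_{a,i},\ r^-_{a,i} : i=1,\dots,m\}>0.$$
   Context: Let $a(Y)=(a_1(Y),\dots,a_m(Y))^T\in\mathbb{R}[Y]^m$ and $b(Y)\in\mathbb{R}[Y]$ with $\mathbb{R}[Y]=\mathbb{R}[Y_1,\dots,Y_n]$, and let $S=\{y\in\mathbb{R}^n : g_1(y)\ge0,\dots,g_s(y)\ge0\}$ with $g_1,\dots,g_s\in\mathbb{R}[Y]$. Standing assumption: $S$ is compact. Put $\mathcal{F}=\{x\in\mathbb{R}^m: a(y)^Tx+b(y)\ge0\ \forall y\in S\}$; $\mathbf{0}$ is the zero vector of $\mathbb{R}^m$. For $i=1,\dots,m$ define the extended real numbers $$r^+_{a,i}:=\inf\{-\lambda : u\in\mathbb{R}^m,\ u_i=1,\ \lambda\in\mathbb{R},\ a(y)^Tu-\lambda\ge0\ \forall y\in S\},$$ $$r^-_{a,i}:=\inf\{-\lambda : u\in\mathbb{R}^m,\ u_i=-1,\ \lambda\in\mathbb{R},\ a(y)^Tu-\lambda\ge0\ \forall y\in S\}.$$ *)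

(* Defs.v *)
From HB Require Import structures.
From mathcomp Require Import all_boot all_order all_algebra.
From mathcomp Require Import all_classical all_reals all_analysis.
(* [mpoly] is only required: importing its notations clashes with those of
   MathComp-Analysis. [mpoly.mpoly n R] is the type {mpoly R[n]}. *)
From mathcomp Require mpoly.

Set Implicit Arguments.
Unset Strict Implicit.
Unset Printing Implicit Defensive.

Import Order.TTheory GRing.Theory Num.Theory.
Import numFieldNormedType.Exports.

Local Open Scope classical_set_scope.
Local Open Scope ring_scope.

(* Points of R^k are row vectors ['rV[R]_k], whose library topology is the usual
   one; the coordinates of [y] are the [y ord0 j]. *)

Definition peval (R : realType) (n : nat) (p : mpoly.mpoly n R)
    (y : 'rV[R]_n) : R :=
  mpoly.meval (y ord0) p.

Definition basic_set (R : realType) (n s : nat)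
    (g : 'I_s -> mpoly.mpoly n R) : set 'rV[R]_n :=
  [set y | forall j, 0 <= peval (g j) y].

(* a(y)^T u *)
Definition pdot (R : realType) (m n : nat) (a : 'I_m -> mpoly.mpoly n R)
    (y : 'rV[R]_n) (u : 'rV[R]_m) : R :=
  \sum_(i < m) peval (a i) y * u ord0 i.

Definition feasible_set (R : realType) (m n : nat)
    (a : 'I_m -> mpoly.mpoly n R) (b : mpoly.mpoly n R)
    (S : set 'rV[R]_n) : set 'rV[R]_m :=
  [set x | forall y, S y -> 0 <= pdot a y x + peval b y].

(* inf {-lambda : u_i = c, a(y)^T u - lambda >= 0 on S}, in the extended reals;
   the infimum of the empty set is +oo. *)
Definition r_coord (R : realType) (m n : nat) (c : R)
    (a : 'I_m -> mpoly.mpoly n R) (S : set 'rV[R]_n) (i : 'I_m) : \bar R :=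
  ereal_inf [set (- p.2)%:E | p in
    [set p : 'rV[R]_m * R |
      p.1 ord0 i = c /\ forall y, S y -> 0 <= pdot a y p.1 - p.2]].

Definition r_plus (R : realType) (m n : nat)
    (a : 'I_m -> mpoly.mpoly n R) (S : set 'rV[R]_n) (i : 'I_m) : \bar R :=
  r_coord 1 a S i.

Definition r_minus (R : realType) (m n : nat)
    (a : 'I_m -> mpoly.mpoly n R) (S : set 'rV[R]_n) (i : 'I_m) : \bar R :=
  r_coord (-1) a S i.

(* The unit +oo is the minimum of the empty family, reached only for m = 0. *)
Definition min_r_pm (R : realType) (m n : nat)
    (a : 'I_m -> mpoly.mpoly n R) (S : set 'rV[R]_n) : \bar R :=
  \big[Order.min/+oo%E]_(i < m) Order.min (r_plus a S i) (r_minus a S i).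

(* Main.v *)
Require Import Defs.
From mathcomp Require Import all_boot all_order all_algebra.
From mathcomp Require Import all_classical all_reals all_analysis.
From mathcomp Require mpoly.
Import Order.TTheory GRing.Theory Num.Theory.
Import numFieldNormedType.Exports.
Local Open Scope classical_set_scope.
Local Open Scope ring_scope.

(** Both conditions are governed by the recession directions of the feasible
    set: nonzero [d] with [a(y)^T d >= 0] on [S].  Such a [d], rescaled so that
    some coordinate is [1] or [-1], gives [r <= 0] with [lambda = 0], and spans
    a ray inside the feasible set because [b >= 0] on [S].  Conversely, if the
    feasible set is unbounded or some [r] is [<= 0], there are unit vectors
    [u] with [a(y)^T u >= - e * c(y)] on [S] for every [e > 0] ([c = b],
    respectively [c = 1]), and a cluster point of them is a recession
    direction. *)

Lemma pdotZ (R : realType) (m n : nat) (a : 'I_m -> mpoly.mpoly n R)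
    (y : 'rV[R]_n) (k : R) (u : 'rV[R]_m) :
  pdot a y (k *: u) = k * pdot a y u.
Proof.
rewrite /pdot mulr_sumr; apply: eq_bigr => i _.
by rewrite mxE mulrCA.
Qed.

Lemma pdot0 (R : realType) (m n : nat) (a : 'I_m -> mpoly.mpoly n R)
    (y : 'rV[R]_n) : pdot a y 0 = 0.
Proof. by rewrite -(scale0r 0) pdotZ mul0r. Qed.

Lemma pdot_continuous (R : realType) (m n : nat)
    (a : 'I_m -> mpoly.mpoly n R) (y : 'rV[R]_n) : continuous (pdot a y).
Proof.
apply: continuous_big => [|i _ u]; first exact: add_continuous.
by apply: cvgMl_tmp; [exact: nbhs_filter|exact: coord_continuous].
Qed.

Lemma closed_pdot_ge0 (R : realType) (m n : nat)
    (a : 'I_m -> mpoly.mpoly n R) (y : 'rV[R]_n) (c : R) :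
  closed [set u | 0 <= pdot a y u + c].
Proof.
rewrite (_ : mkset _ = (fun u => pdot a y u + c) @^-1` [set r | 0 <= r])//.
apply: preimage_closed; last exact: closed_ge.
move=> u _; apply: cvgD; first exact: nbhs_filter.
  exact: pdot_continuous.
exact: cst_continuous.
Qed.

Lemma compact_sphere (R : realType) (m : nat) :
  compact [set u : 'rV[R]_m | `|u| = 1].
Proof.
apply: bounded_closed_compact.
  by exists 1; split => // M M1 u /= ->; exact: ltW.
rewrite (_ : mkset _ = (fun u : 'rV[R]_m => `|u|) @^-1` [set r | r = 1])//.
apply: preimage_closed => [u _|]; last exact: closed_eq.
exact: norm_continuous.
Qed.

(** The unit vectors for [e = 1/(k+1)] cluster on the compact unit sphere, which keeps the limit
    nonzero. The error [e * c y] vanishes in the limit for each fixed [y]. *)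
Lemma recession_direction_of_approx (R : realType) (m n : nat)
    (a : 'I_m -> mpoly.mpoly n R) (S : set 'rV[R]_n) (c : 'rV[R]_n -> R) :
  (forall y, S y -> 0 <= c y) ->
  (forall e, 0 < e -> exists2 u : 'rV[R]_m, `|u| = 1 &
    forall y, S y -> 0 <= pdot a y u + e * c y) ->
  exists2 d : 'rV[R]_m, d != 0 & forall y, S y -> 0 <= pdot a y d.
Proof.
move=> c0 H.
have {}H (k : nat) : exists u : 'rV[R]_m, `|u| = 1 /\
    forall y, S y -> 0 <= pdot a y u + k.+1%:R^-1 * c y.
  by have [|u u1 uS] := H k.+1%:R^-1; [rewrite invr_gt0|exists u].
have [u_ Hu] := choice H.
have [] := @compact_sphere R m (u_ @ \oo) _.
  by exists 0%N => // k _ /=; exact: (Hu k).1.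
move=> d [/= d1 clu]; exists d; first by rewrite -normr_eq0 d1 oner_eq0.
(* With a slack [e], the condition at [y] defines a closed set; it contains a tail of [u_], hence
   the cluster point [d]. *)
move=> y Sy; apply/ler_addgt0Pr => e e0.
(* Adding 1 keeps the divisor positive when [c y = 0]; the tail begins once
   [1/(k+1) < e / (c y + 1)]. *)
have cy1 : 0 < c y + 1 by rewrite ltr_wpDl ?c0.
have cle : closed [set u : 'rV[R]_m | 0 <= pdot a y u + e].
  exact: closed_pdot_ge0.
apply: cle; move: clu; rewrite clusterE; apply.
change (\forall k \near \oo, 0 <= pdot a y (u_ k) + e).
near=> k; have [_ /(_ _ Sy)/le_trans] := Hu k; apply.
rewrite lerD2l.
apply: (@le_trans _ _ (e / (c y + 1) * c y)).
  rewrite ler_wpM2r ?c0// ltW//.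
  by near: k; exact: (near_infty_natSinv_lt (PosNum (divr_gt0 e0 cy1))).
by rewrite mulrAC ler_pdivrMr// ler_wpM2l ?ltW// ltrDl.
Unshelve. all: by end_near. Qed.

Lemma r_coord_le0 (R : realType) (m n : nat) (c : R)
    (a : 'I_m -> mpoly.mpoly n R) (S : set 'rV[R]_n) (i : 'I_m)
    (d : 'rV[R]_m) :
  d ord0 i = c -> (forall y, S y -> 0 <= pdot a y d) ->
  (r_coord c a S i <= 0)%E.
Proof.
move=> di dS; apply: ereal_inf_lbound; exists (d, 0); last by rewrite oppr0.
by split=> //= y Sy; rewrite subr0 dS.
Qed.

Lemma recession_direction_of_r_coord_le0 (R : realType) (m n : nat) (c : R)
    (a : 'I_m -> mpoly.mpoly n R) (S : set 'rV[R]_n) (i : 'I_m) :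
  `|c| = 1 -> (r_coord c a S i <= 0)%E ->
  exists2 d : 'rV[R]_m, d != 0 & forall y, S y -> 0 <= pdot a y d.
Proof.
move=> c1 r0; apply: (@recession_direction_of_approx _ _ _ _ _ (cst 1)) => //.
move=> e e0; have : (r_coord c a S i < e%:E)%E
  by rewrite (le_lt_trans r0)// lte_fin.
move=> /ereal_inf_lt[_ [[u l] /= [ui uS] <-]]; rewrite lte_fin => le.
have u1 : 1 <= `|u|.
  rewrite -c1 -ui [leRHS]/Num.Def.normr/= mx_normrE.
  by apply/bigmax_geP; right => /=; exists (ord0, i).
have u0 : 0 < `|u| by exact: lt_le_trans u1.
exists (`|u|^-1 *: u).
  by rewrite normrZ normfV normr_id mulVf// gt_eqF.
move=> y Sy; rewrite pdotZ mulr1 -(pmulr_rge0 _ u0) mulrDr mulVKf ?gt_eqF//.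
rewrite (le_trans (uS _ Sy))// lerD2l (le_trans (ltW le))//.
by rewrite ler_peMl// ltW.
Qed.

Lemma min_r_pm_gt0P (R : realType) (m n : nat)
    (a : 'I_m -> mpoly.mpoly n R) (S : set 'rV[R]_n) :
  (0 < min_r_pm a S)%E <->
  ~ exists2 d : 'rV[R]_m, d != 0 & forall y, S y -> 0 <= pdot a y d.
Proof.
split=> [/bigmin_gtP[_ r0] [d d0 dS]|nrec].
  have [i di0] : exists i, d ord0 i != 0.
    by apply/existsP; move: d0; apply: contraNT => /existsPn d0;
      apply/eqP/rowP => i; rewrite mxE; apply/eqP/negbNE/d0.
  (* Dividing by the absolute value preserves the sign of the coordinate: it becomes 1, against
     [r_plus], or -1, against [r_minus]. *)
  have dS' y : S y -> 0 <= pdot a y (`|d ord0 i|^-1 *: d).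
    by move=> Sy; rewrite pdotZ mulr_ge0 ?invr_ge0// dS.
  move: (r0 i isT); rewrite lt_min => /andP[]; rewrite !ltNge.
  have [dneg|dpos|deq] := ltgtP (d ord0 i) 0.
  - move=> _ /negP[]; apply: r_coord_le0 dS'.
    by rewrite mxE ltr0_norm// invrN mulNr mulVf.
  - move=> /negP[]; apply: r_coord_le0 dS'.
    by rewrite mxE gtr0_norm// mulVf.
  - by rewrite deq eqxx in di0.
(* The default value [+oo] is positive, which also settles [m = 0]. *)
apply/bigmin_gtP; split => // i _; rewrite lt_min !ltNge.
by apply/andP; split; apply/negP => r0; apply: nrec;
  apply: recession_direction_of_r_coord_le0 r0; rewrite ?normrN normr1.
Qed.

Lemma closed_feasible_set (R : realType) (m n : nat)
    (a : 'I_m -> mpoly.mpoly n R) (b : mpoly.mpoly n R) (S : set 'rV[R]_n) :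
  closed (feasible_set a b S).
Proof.
rewrite (_ : feasible_set a b S =
    \bigcap_(y in S) [set u | 0 <= pdot a y u + peval b y])//.
by apply: closed_bigI => y _; exact: closed_pdot_ge0.
Qed.

Lemma feasible_set0P (R : realType) (m n : nat)
    (a : 'I_m -> mpoly.mpoly n R) (b : mpoly.mpoly n R) (S : set 'rV[R]_n) :
  feasible_set a b S 0 <-> forall y, S y -> 0 <= peval b y.
Proof. by split=> H y /H; rewrite pdot0 add0r. Qed.

(** Since the feasible set is always closed, only its boundedness is at stake. *)
Lemma compact_feasible_setP (R : realType) (m n : nat)
    (a : 'I_m -> mpoly.mpoly n R) (b : mpoly.mpoly n R) (S : set 'rV[R]_n) :
  feasible_set a b S 0 ->
  compact (feasible_set a b S) <->
  ~ exists2 d : 'rV[R]_m, d != 0 & forall y, S y -> 0 <= pdot a y d.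
Proof.
move=> /feasible_set0P b0; split=> [cF [d d0 dS]|nrec].
  have [M [_ FM]] := compact_bounded cF.
  have nd : 0 < `|d| by rewrite normr_gt0.
  (* [M] may be negative; [M'] is a positive bound above it, violated by the point of norm [M' + 1]
     on the ray spanned by [d]. *)
  pose M' := Num.max M 0 + 1.
  have M'0 : 0 < M' by rewrite ltr_wpDl// le_max lexx orbT.
  have /FM : M < M' by rewrite ltr_pwDr// le_max lexx.
  move=> /(_ ((M' + 1) / `|d| *: d)) /=.
  have k0 : 0 <= (M' + 1) / `|d| by rewrite divr_ge0// addr_ge0// ltW.
  rewrite normrZ ger0_norm// divfK ?gt_eqF// => H.
  suff : M' + 1 <= M' by rewrite leNgt ltrDl ltr01.
  by apply: H => y Sy; rewrite pdotZ addr_ge0 ?b0// mulr_ge0// dS.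
apply: bounded_closed_compact; last exact: closed_feasible_set.
apply: contrapT => nbd; apply: nrec.
apply: (@recession_direction_of_approx _ _ _ a S (peval b)) => [|e e0];
  first exact: b0.
have [x Fx xe] : exists2 x, feasible_set a b S x & e^-1 < `|x|.
  apply: contrapT => nx; apply: nbd; exists e^-1; split => [|M eM x Fx] /=.
    by rewrite realV gtr0_real.
  rewrite leNgt; apply/negP => Mx; apply: nx.
  by exists x => //; exact: lt_trans Mx.
have x0 : 0 < `|x| by rewrite (lt_trans _ xe)// invr_gt0.
exists (`|x|^-1 *: x).
  by rewrite normrZ normfV normr_id mulVf// gt_eqF.
move=> y Sy; rewrite pdotZ -(pmulr_rge0 _ x0) mulrDr mulVKf ?gt_eqF//.
rewrite (le_trans (Fx _ Sy))// lerD2l mulrA ler_peMl ?b0//.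
by rewrite -ler_pdivrMr// div1r ltW.
Qed.

Theorem corollary3p16 (R : realType) (m n s : nat)
    (a : 'I_m -> mpoly.mpoly n R) (b : mpoly.mpoly n R)
    (g : 'I_s -> mpoly.mpoly n R)
    (hS : compact (basic_set g)) :
  (feasible_set a b (basic_set g) 0 <->
     forall y, basic_set g y -> 0 <= peval b y) /\
  (feasible_set a b (basic_set g) 0 ->
     (compact (feasible_set a b (basic_set g)) <->
      (0 < min_r_pm a (basic_set g))%E)).
Proof.
split; first exact: feasible_set0P.
by move=> F0; rewrite compact_feasible_setP// min_r_pm_gt0P.
Qed.
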